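(* Let $G$ be a group, let $L$ be a $G$-set, and let $\tilde M\colon G\text{-}\mathbf{Set}\to\mathbf{Set}$ be the functor sending a $G$-set $X$ to its set of orbits $X/G$. For a $G$-equivariant map $h\colon L\to G$ (where $G$ acts on itself by left multiplication) and a $G$-set $N$, let $\tilde\lambda^h_N\colon L\times N\to G\tilde\times N$ be the $G$-equivariant map $\tilde\lambda^h_N(b,n)=(h(b),h(b)^{-1}n)$, and let $\lambda^h$ be the left $\chi$-coalgebra structure on $\tilde M$ with components $$\lambda^h_N\colon (L\times N)/G\to (G\tilde\times N)/G,\qquad [b,n]\mapsto[\tilde\lambda^h_N(b,n)].$$ Then the left $\chi$-coalgebra structures $\lambda^h$ on $\tilde M$ (with $h\colon L\to G$ ranging over $G$-equivariant maps) correspond bijectively to the $\mathbb Q$-opcoalgebra structures on $\tilde M V$, via the assignment sending $\lambda$ to the natural transformation $\tilde M V\Rightarrow \tilde M VQ$ with component at $(X,\beta)$ given by $X/G\to(G\tilde\times X)/G$, $[x]\mapsto\lambda_X([\beta_1(x),x])$.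
   Context: $G$ is a group with unit $1$; $G$-sets are left $G$-sets, and morphisms in $G\text{-}\mathbf{Set}$ are $G$-equivariant maps. $L$ is a fixed $G$-set. Comonad $\mathbb S=(S,\Delta,\varepsilon)$ on $G\text{-}\mathbf{Set}$: $S=L\times-$ with diagonal action $g(l,n)=(gl,gn)$, $\Delta_N(l,n)=(l,l,n)$, $\varepsilon_N(l,n)=n$. Comonad $\mathbb T=(T,\tilde\Delta,\tilde\varepsilon)$ on $G\text{-}\mathbf{Set}$: $TN=G\tilde\times N$ is the set $G\times N$ with action $g(a,n)=(ga,n)$; on morphisms $T(f)(a,n)=(a,f(n))$; $\tilde\Delta_N(g,n)=(g,1,n)$, $\tilde\varepsilon_N(g,n)=gn$. Distributive law $\chi\colon TS\Rightarrow ST$: $\chi_N\colon G\tilde\times(L\times N)\to L\times(G\tilde\times N)$, $(g,l,n)\mapsto(gl,g,n)$. A left $\chi$-coalgebra structure on a functor $M\colon G\text{-}\mathbf{Set}\to\mathcal Z$ is a natural transformation $\lambda\colon MS\Rightarrow MT$ with $M\tilde\varepsilon\circ\lambda=M\varepsilon$ and $M\tilde\Delta\circ\lambda=\lambda T\circ M\chi\circ\lambda S\circ M\Delta$. $(G\text{-}\mathbf{Set})_{\mathbb S}$ is the category of $\mathbb S$-coalgebras: pairs $(X,\beta)$ with $X$ a $G$-set and $\beta\colon X\to L\times X$ a $G$-equivariant map which is a coalgebra structure; necessarily $\beta(x)=(\beta_1(x),x)$ for a $G$-equivariant map $\beta_1\colon X\to L$. $V\colon(G\text{-}\mathbf{Set})_{\mathbb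 S}\to G\text{-}\mathbf{Set}$ is the forgetful functor $(X,\beta)\mapsto X$. Comonad $\mathbb Q=(Q,\Delta^{\mathbb Q},\varepsilon^{\mathbb Q})$ on $(G\text{-}\mathbf{Set})_{\mathbb S}$: $Q(X,\beta)=(G\tilde\times X,\ \chi_X\circ(G\tilde\times\beta))$, i.e. with coalgebra structure $(g,x)\mapsto(g\beta_1(x),g,x)$; $Q(f)=G\tilde\times f$; $\Delta^{\mathbb Q}_{(X,\beta)}(g,x)=(g,1,x)$; $\varepsilon^{\mathbb Q}_{(X,\beta)}(g,x)=gx$. A $\mathbb Q$-opcoalgebra structure on a functor $P\colon(G\text{-}\mathbf{Set})_{\mathbb S}\to\mathcal Z$ is a natural transformation $\nabla\colon P\Rightarrow PQ$ with $P\varepsilon^{\mathbb Q}\circ\nabla=\mathrm{id}$ and $P\Delta^{\mathbb Q}\circ\nabla=\nabla Q\circ\nabla$. *)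

(* Defs.v *)
From mathcomp Require Import all_boot.
From mathcomp Require Import boolp classical_sets.

Set Implicit Arguments.
Unset Strict Implicit.
Unset Printing Implicit Defensive.

Declare Scope cat_scope.
Delimit Scope cat_scope with cat.
Local Open Scope cat_scope.
Local Open Scope group_scope.

(* [f] restricts to a bijection from [P] onto [R]. The library's [set_bij] cannot
   be used for classes of natural transformations between functors on G-sets:
   its universe lies below that of [groupType] carriers. *)
Definition bij_between (A B : Type) (P : A -> Prop) (R : B -> Prop)
    (f : A -> B) : Prop :=
  [/\ forall a, P a -> R (f a),
      forall a a', P a -> P a' -> f a = f a' -> a = a'
    & forall b, R b -> exists2 a, P a & f a = b].

Record category := Category {
  ob :> Type;
  hom : ob -> ob -> Type;
  idm : forall a, hom a a;
  comp : forall a b c, hom b c -> hom a b -> hom a c;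
  comp1m : forall a b (f : hom a b), comp (idm b) f = f;
  compm1 : forall a b (f : hom a b), comp f (idm a) = f;
  compmA : forall a b c d (h : hom c d) (g : hom b c) (f : hom a b),
    comp h (comp g f) = comp (comp h g) f
}.
Arguments hom {c} a b : rename.
Arguments idm {c} a : rename.
Arguments comp {c a b} {c0} g f : rename.

Notation "g \oc f" := (comp g f) (at level 50, left associativity) : cat_scope.

Record functor (C D : category) := Functor {
  fobj :> C -> D;
  fmap : forall a b, hom a b -> hom (fobj a) (fobj b);
  fmap1 : forall a, fmap (idm a) = idm (fobj a);
  fmapM : forall a b c (g : hom b c) (f : hom a b),
    fmap (g \oc f) = fmap g \oc fmap f
}.
Arguments fmap {C D} F {a b} f : rename.

Section FunctorComposition.
Variables (C D E : category) (F : functor D E) (K : functor C D).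

Lemma fcomp1 a : fmap F (fmap K (idm a)) = idm (F (K a)).
Proof. by rewrite !fmap1. Qed.

Lemma fcompM a b c (g : hom b c) (f : hom a b) :
  fmap F (fmap K (g \oc f)) = fmap F (fmap K g) \oc fmap F (fmap K f).
Proof. by rewrite !fmapM. Qed.

Definition fcomp : functor C E := Functor fcomp1 fcompM.

End FunctorComposition.

Notation "F \of K" := (fcomp F K) (at level 50, left associativity) : cat_scope.

Definition fid (C : category) : functor C C :=
  @Functor C C id (fun _ _ f => f) (fun _ => erefl) (fun _ _ _ _ _ => erefl).

Record nat_trans (C D : category) (F K : functor C D) := NatTrans {
  ntc :> forall a, hom (F a) (K a);
  nt_nat : forall a b (f : hom a b), fmap K f \oc ntc a = ntc b \oc fmap F f
}.

Lemma nat_trans_ext (C D : category) (F K : functor C D) (s t : nat_trans F K) :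
  (forall a, s a = t a) -> s = t.
Proof.
case: s t => [s hs] [t ht] /= st.
have {}st : s = t by apply: functional_extensionality_dep.
by subst t; congr NatTrans; apply: Prop_irrelevance.
Qed.

Section WhiskerLeft.
Variables (C D E : category) (M : functor D E) (F K : functor C D).
Variable t : nat_trans F K.

Lemma whiskerl_nat a b (f : hom a b) :
  fmap (M \of K) f \oc fmap M (t a) = fmap M (t b) \oc fmap (M \of F) f.
Proof. by rewrite /= -!fmapM nt_nat. Qed.

Definition whiskerl : nat_trans (M \of F) (M \of K) :=
  @NatTrans _ _ (M \of F) (M \of K) _ whiskerl_nat.

End WhiskerLeft.

Record comonad (C : category) := Comonad {
  cfun :> functor C C;
  comul : nat_trans cfun (cfun \of cfun);
  counit : nat_trans cfun (fid C);
  comonad_counitl : forall a, counit (cfun a) \oc comul a = idm (cfun a);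
  comonad_counitr : forall a, fmap cfun (counit a) \oc comul a = idm (cfun a);
  comonad_coassoc : forall a,
    comul (cfun a) \oc comul a = fmap cfun (comul a) \oc comul a
}.

Record distr_law (C : category) (T S : comonad C) := DistrLaw {
  dlaw :> nat_trans (T \of S) (S \of T);
  dlaw_counitT : forall a, fmap S (counit T a) \oc dlaw a = counit T (S a);
  dlaw_counitS : forall a, counit S (T a) \oc dlaw a = fmap T (counit S a);
  dlaw_comulT : forall a,
    fmap S (comul T a) \oc dlaw a
    = dlaw (T a) \oc fmap T (dlaw a) \oc comul T (S a);
  dlaw_comulS : forall a,
    comul S (T a) \oc dlaw a
    = fmap S (dlaw a) \oc dlaw (S a) \oc fmap T (comul S a)
}.

Definition is_chi_coalgebra (C Z : category) (S T : comonad C)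
    (chi : distr_law T S) (M : functor C Z)
    (lam : nat_trans (M \of S) (M \of T)) : Prop :=
  (forall a, fmap M (counit T a) \oc lam a = fmap M (counit S a)) /\
  (forall a, fmap M (comul T a) \oc lam a
     = lam (T a) \oc fmap M (chi a) \oc lam (S a) \oc fmap M (comul S a)).

Definition is_opcoalgebra (C Z : category) (Q : comonad C) (P : functor C Z)
    (nabla : nat_trans P (P \of Q)) : Prop :=
  (forall a, fmap P (counit Q a) \oc nabla a = idm (P a)) /\
  (forall a, fmap P (comul Q a) \oc nabla a = nabla (Q a) \oc nabla a).

Record coalgebra (C : category) (S : comonad C) := Coalgebra {
  coalg_ob : C;
  coact : hom coalg_ob (S coalg_ob);
  coact_counit : counit S coalg_ob \oc coact = idm coalg_ob;
  coact_coassoc : comul S coalg_ob \oc coact = fmap S coact \oc coact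
}.
Arguments coact {C S} X : rename.

Record coalg_hom (C : category) (S : comonad C) (X Y : coalgebra S) := CoalgHom {
  coalg_mor :> hom (coalg_ob X) (coalg_ob Y);
  coalg_morP : fmap S coalg_mor \oc coact X = coact Y \oc coalg_mor
}.

Section CoalgebraCategory.
Variables (C : category) (S : comonad C).

Lemma coalg_hom_ext (X Y : coalgebra S) (f g : coalg_hom X Y) :
  coalg_mor f = coalg_mor g -> f = g.
Proof.
case: f g => [f hf] [g hg] /= fg; subst g.
by congr CoalgHom; apply: Prop_irrelevance.
Qed.

Lemma coalg_idP (X : coalgebra S) :
  fmap S (idm (coalg_ob X)) \oc coact X = coact X \oc idm (coalg_ob X).
Proof. by rewrite fmap1 comp1m compm1. Qed.

Lemma coalg_compP (X Y W : coalgebra S) (g : coalg_hom Y W) (f : coalg_hom X Y) :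
  fmap S (coalg_mor g \oc coalg_mor f) \oc coact X
  = coact W \oc (coalg_mor g \oc coalg_mor f).
Proof. by rewrite fmapM -compmA coalg_morP !compmA coalg_morP. Qed.

Definition coalg_id X := CoalgHom (coalg_idP X).
Definition coalg_comp X Y W g f := CoalgHom (@coalg_compP X Y W g f).

Lemma coalg_comp1m X Y (f : coalg_hom X Y) : coalg_comp (coalg_id Y) f = f.
Proof. by apply: coalg_hom_ext; rewrite /= comp1m. Qed.

Lemma coalg_compm1 X Y (f : coalg_hom X Y) : coalg_comp f (coalg_id X) = f.
Proof. by apply: coalg_hom_ext; rewrite /= compm1. Qed.

Lemma coalg_compmA X Y W W' (h : coalg_hom W W') (g : coalg_hom Y W)
    (f : coalg_hom X Y) :
  coalg_comp h (coalg_comp g f) = coalg_comp (coalg_comp h g) f.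
Proof. by apply: coalg_hom_ext; rewrite /= compmA. Qed.

Definition coalg_cat : category :=
  Category coalg_comp1m coalg_compm1 coalg_compmA.

Definition forget : functor coalg_cat C :=
  @Functor coalg_cat C (@coalg_ob C S) (fun X Y f => coalg_mor f)
    (fun _ => erefl) (fun _ _ _ _ _ => erefl).

End CoalgebraCategory.

Section Lift.
Variables (C : category) (S T : comonad C) (chi : distr_law T S).
Local Notation CS := (coalg_cat S).

Definition lift_coact (X : CS) := chi (coalg_ob X) \oc fmap T (coact X).

Lemma lift_counit (X : CS) :
  counit S (T (coalg_ob X)) \oc lift_coact X = idm (T (coalg_ob X)).
Proof.
by rewrite /lift_coact compmA dlaw_counitS -fmapM coact_counit fmap1.
Qed.

Lemma lift_coassoc (X : CS) :
  comul S (T (coalg_ob X)) \oc lift_coact X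
  = fmap S (lift_coact X) \oc lift_coact X.
Proof.
rewrite /lift_coact compmA dlaw_comulS -!compmA -fmapM coact_coassoc !fmapM.
rewrite -!compmA; congr (_ \oc _); rewrite !compmA; congr (_ \oc _).
by rewrite -[LHS]/(chi _ \oc fmap (T \of S) _) -nt_nat.
Qed.

Definition lift_ob (X : CS) : CS := Coalgebra (lift_counit X) (lift_coassoc X).

Lemma lift_morP (X Y : CS) (f : coalg_hom X Y) :
  fmap S (fmap T f) \oc lift_coact X = lift_coact Y \oc fmap T f.
Proof.
rewrite /lift_coact compmA (nt_nat chi f) -!compmA /= -!fmapM.
by rewrite coalg_morP.
Qed.

Definition lift_mor (X Y : CS) (f : @hom CS X Y) : @hom CS (lift_ob X) (lift_ob Y) :=
  @CoalgHom C S (lift_ob X) (lift_ob Y) _ (lift_morP f).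

Lemma lift_mor1 X : lift_mor (idm X) = idm (lift_ob X).
Proof. by apply: coalg_hom_ext; rewrite /= fmap1. Qed.

Lemma lift_morM (X Y W : CS) (g : hom Y W) (f : hom X Y) :
  lift_mor (g \oc f) = lift_mor g \oc lift_mor f.
Proof. by apply: coalg_hom_ext; rewrite /= fmapM. Qed.

Definition lift_functor : functor CS CS := Functor lift_mor1 lift_morM.

Lemma lift_epsP (X : CS) :
  fmap S (counit T (coalg_ob X)) \oc lift_coact X
  = coact X \oc counit T (coalg_ob X).
Proof.
by rewrite /lift_coact compmA dlaw_counitT -(nt_nat (counit T) (coact X)).
Qed.

Lemma lift_deltaP (X : CS) :
  fmap S (comul T (coalg_ob X)) \oc lift_coact X
  = lift_coact (lift_ob X) \oc comul T (coalg_ob X).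
Proof.
rewrite /lift_coact compmA dlaw_comulT -!compmA.
rewrite -(nt_nat (comul T) (coact X)) /= /lift_coact.
by rewrite fmapM !compmA.
Qed.

Definition lift_eps (X : CS) : @hom CS (lift_ob X) X :=
  @CoalgHom C S (lift_ob X) X _ (lift_epsP X).

Definition lift_delta (X : CS) : @hom CS (lift_ob X) (lift_ob (lift_ob X)) :=
  @CoalgHom C S (lift_ob X) (lift_ob (lift_ob X)) _ (lift_deltaP X).

Lemma lift_eps_nat (X Y : CS) (f : hom X Y) :
  fmap (fid CS) f \oc lift_eps X = lift_eps Y \oc fmap lift_functor f.
Proof. by apply: coalg_hom_ext => /=; rewrite -(nt_nat (counit T)). Qed.

Lemma lift_delta_nat (X Y : CS) (f : hom X Y) :
  fmap (lift_functor \of lift_functor) f \oc lift_delta X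
  = lift_delta Y \oc fmap lift_functor f.
Proof. by apply: coalg_hom_ext => /=; rewrite -(nt_nat (comul T)). Qed.

Definition lift_comul : nat_trans lift_functor (lift_functor \of lift_functor) :=
  @NatTrans _ _ lift_functor (lift_functor \of lift_functor) _ lift_delta_nat.

Definition lift_counit_nt : nat_trans lift_functor (fid CS) :=
  @NatTrans _ _ lift_functor (fid CS) _ lift_eps_nat.

Lemma lift_counitl (X : CS) :
  lift_counit_nt (lift_functor X) \oc lift_comul X = idm (lift_functor X).
Proof. by apply: coalg_hom_ext; rewrite /= comonad_counitl. Qed.

Lemma lift_counitr (X : CS) :
  fmap lift_functor (lift_counit_nt X) \oc lift_comul X = idm (lift_functor X).
Proof. by apply: coalg_hom_ext; rewrite /= comonad_counitr. Qed.

Lemma lift_coassociative (X : CS) :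
  lift_comul (lift_functor X) \oc lift_comul X
  = fmap lift_functor (lift_comul X) \oc lift_comul X.
Proof. by apply: coalg_hom_ext; rewrite /= comonad_coassoc. Qed.

Definition lift_comonad : comonad CS :=
  Comonad lift_counitl lift_counitr lift_coassociative.

Section ToOp.
Variables (Z : category) (M : functor C Z).
Variable lam : nat_trans (M \of S) (M \of T).

Definition toop_comp (X : CS) : hom (M (coalg_ob X)) (M (T (coalg_ob X))) :=
  lam (coalg_ob X) \oc fmap M (coact X).

Lemma toop_nat (X Y : CS) (f : hom X Y) :
  fmap ((M \of forget S) \of lift_comonad) f \oc toop_comp X
  = toop_comp Y \oc fmap (M \of forget S) f.
Proof.
rewrite /toop_comp compmA (nt_nat lam (coalg_mor f)) -!compmA /= -!fmapM.
by rewrite coalg_morP.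
Qed.

Definition toop :
    nat_trans (M \of forget S) ((M \of forget S) \of lift_comonad) :=
  @NatTrans _ _ (M \of forget S) ((M \of forget S) \of lift_comonad) _ toop_nat.

End ToOp.

End Lift.

Definition type_cat : category :=
  @Category Type (fun A B => A -> B) (fun A => id) (fun A B C g f => g \o f)
    (fun _ _ _ => erefl) (fun _ _ _ => erefl) (fun _ _ _ _ _ _ _ => erefl).

Record gset (G : groupType) := GSet {
  gset_sort :> Type;
  act : G -> gset_sort -> gset_sort;
  act1 : forall x, act 1 x = x;
  actM : forall g k x, act (g * k) x = act g (act k x)
}.
Arguments act {G X} g x : rename.

Record ghom (G : groupType) (X Y : gset G) := GHom {
  ghom_fun :> X -> Y;
  ghomP : forall g x, ghom_fun (act g x) = act g (ghom_fun x)
}.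

Lemma ghom_ext (G : groupType) (X Y : gset G) (f k : ghom X Y) :
  f =1 k -> f = k.
Proof.
case: f k => [f hf] [k hk] /= fk.
have {}fk : f = k by apply: funext.
by subst k; congr GHom; apply: Prop_irrelevance.
Qed.

Section GSets.
Variable G : groupType.

Definition ghom_id (X : gset G) : ghom X X := @GHom G X X id (fun _ _ => erefl).

Lemma ghom_compP (X Y Z : gset G) (k : ghom Y Z) (f : ghom X Y) g x :
  k (f (act g x)) = act g (k (f x)).
Proof. by rewrite !ghomP. Qed.

Definition ghom_comp (X Y Z : gset G) (k : ghom Y Z) (f : ghom X Y) : ghom X Z :=
  GHom (ghom_compP k f).

Lemma ghom_comp1m X Y (f : ghom X Y) : ghom_comp (ghom_id Y) f = f.
Proof. exact: ghom_ext. Qed.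

Lemma ghom_compm1 X Y (f : ghom X Y) : ghom_comp f (ghom_id X) = f.
Proof. exact: ghom_ext. Qed.

Lemma ghom_compmA X Y Z W (h : ghom Z W) (k : ghom Y Z) (f : ghom X Y) :
  ghom_comp h (ghom_comp k f) = ghom_comp (ghom_comp h k) f.
Proof. exact: ghom_ext. Qed.

Definition gset_cat : category := Category ghom_comp1m ghom_compm1 ghom_compmA.

Definition regular : gset G := @GSet G G (fun g k => g * k) (@mul1g G)
  (fun g k x => esym (mulgA g k x)).

Section Orbits.
Variable X : gset G.

Definition gorbit (x : X) : set X := range (fun g : G => act g x).

Definition orbits : Type := {A : set X | exists x, A = gorbit x}.

Definition orbit_class (x : X) : orbits :=
  exist _ (gorbit x) (ex_intro _ x erefl).

Lemma orbits_ext (A B : orbits) : sval A = sval B -> A = B.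
Proof. by case: A B => [A hA] [B hB] /= AB; apply: eq_exist. Qed.

End Orbits.

Lemma image_gorbit (X Y : gset G) (f : ghom X Y) (x : X) :
  (f @` gorbit x)%classic = gorbit (f x).
Proof.
rewrite /gorbit image_comp; congr image; apply: funext => g /=.
exact: ghomP.
Qed.

Lemma orbits_mapP (X Y : gset G) (f : ghom X Y) (A : orbits X) :
  exists y, (f @` sval A)%classic = gorbit y.
Proof. by case: A => A [x Ax] /=; exists (f x); rewrite Ax; apply: image_gorbit. Qed.

Definition orbits_map (X Y : gset G) (f : ghom X Y) (A : orbits X) : orbits Y :=
  exist _ (f @` sval A)%classic (orbits_mapP f A).

Lemma orbits_map_class (X Y : gset G) (f : ghom X Y) (x : X) :
  orbits_map f (orbit_class x) = orbit_class (f x).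
Proof. by apply: orbits_ext; apply: image_gorbit. Qed.

Lemma orbits_map1 (X : gset_cat) :
  orbits_map (idm X) = idm (orbits X : type_cat).
Proof. by apply: funext => A; apply: orbits_ext; apply: image_id. Qed.

Lemma orbits_mapM (X Y Z : gset_cat) (k : hom Y Z) (f : hom X Y) :
  orbits_map (k \oc f) = orbits_map k \o orbits_map f.
Proof. by apply: funext => A; apply: orbits_ext; rewrite /= image_comp. Qed.

Definition orbits_functor : functor gset_cat type_cat :=
  @Functor gset_cat type_cat orbits orbits_map orbits_map1 orbits_mapM.

Section ComonadS.
Variable L : gset G.

Definition prod_gset (N : gset G) : gset G.
Proof.
refine (@GSet G (L * N)%type (fun g p => (act g p.1, act g p.2)) _ _).
- by case=> l n /=; rewrite !act1.
- by move=> g k [l n] /=; rewrite !actM.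
Defined.

Definition prod_map (N N' : gset G) (f : ghom N N') :
  ghom (prod_gset N) (prod_gset N').
Proof.
refine (@GHom G (prod_gset N) (prod_gset N') (fun p => (p.1, f p.2)) _).
by move=> g [l n] /=; rewrite ghomP.
Defined.

Definition S_functor : functor gset_cat gset_cat.
Proof.
refine (@Functor gset_cat gset_cat prod_gset prod_map _ _).
- by move=> N; apply: ghom_ext => -[].
- by move=> N1 N2 N3 k f; apply: ghom_ext.
Defined.

Definition S_delta (N : gset G) : ghom (prod_gset N) (prod_gset (prod_gset N)) :=
  @GHom G (prod_gset N) (prod_gset (prod_gset N))
    (fun p => (p.1, (p.1, p.2))) (fun _ _ => erefl).

Definition S_eps (N : gset G) : ghom (prod_gset N) N :=
  @GHom G (prod_gset N) N (fun p => p.2) (fun _ _ => erefl).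

Definition S_comul : nat_trans S_functor (S_functor \of S_functor).
Proof.
refine (@NatTrans _ _ S_functor (S_functor \of S_functor) S_delta _).
by move=> N N' f; apply: ghom_ext.
Defined.

Definition S_counit : nat_trans S_functor (fid gset_cat).
Proof.
refine (@NatTrans _ _ S_functor (fid gset_cat) S_eps _).
by move=> N N' f; apply: ghom_ext.
Defined.

Definition S_comonad : comonad gset_cat.
Proof.
refine (@Comonad gset_cat S_functor S_comul S_counit _ _ _).
- by move=> N; apply: ghom_ext => -[].
- by move=> N; apply: ghom_ext => -[].
- by move=> N; apply: ghom_ext.
Defined.

End ComonadS.

Definition tw_gset (N : gset G) : gset G.
Proof.
refine (@GSet G (G * N)%type (fun g p => (g * p.1, p.2)) _ _).
- by case=> a n /=; rewrite mul1g.
- by move=> g k [a n] /=; rewrite mulgA.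
Defined.

Definition tw_map (N N' : gset G) (f : ghom N N') :
    ghom (tw_gset N) (tw_gset N') :=
  @GHom G (tw_gset N) (tw_gset N') (fun p => (p.1, f p.2)) (fun _ _ => erefl).

Definition T_functor : functor gset_cat gset_cat.
Proof.
refine (@Functor gset_cat gset_cat tw_gset tw_map _ _).
- by move=> N; apply: ghom_ext => -[].
- by move=> N1 N2 N3 k f; apply: ghom_ext.
Defined.

Definition T_delta (N : gset G) : ghom (tw_gset N) (tw_gset (tw_gset N)) :=
  @GHom G (tw_gset N) (tw_gset (tw_gset N))
    (fun p => (p.1, (1, p.2))) (fun _ _ => erefl).

Definition T_eps (N : gset G) : ghom (tw_gset N) N.
Proof.
refine (@GHom G (tw_gset N) N (fun p => act p.1 p.2) _).
by move=> g [a n] /=; rewrite actM.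
Defined.

Definition T_comul : nat_trans T_functor (T_functor \of T_functor).
Proof.
refine (@NatTrans _ _ T_functor (T_functor \of T_functor) T_delta _).
by move=> N N' f; apply: ghom_ext.
Defined.

Definition T_counit : nat_trans T_functor (fid gset_cat).
Proof.
refine (@NatTrans _ _ T_functor (fid gset_cat) T_eps _).
by move=> N N' f; apply: ghom_ext => -[a n] /=; rewrite ghomP.
Defined.

Definition T_comonad : comonad gset_cat.
Proof.
refine (@Comonad gset_cat T_functor T_comul T_counit _ _ _).
- by move=> N; apply: ghom_ext => -[a n] /=; rewrite mulg1.
- by move=> N; apply: ghom_ext => -[a n] /=; rewrite act1.
- by move=> N; apply: ghom_ext.
Defined.

Section Chi.
Variable L : gset G.
Local Notation S := (S_comonad L).
Local Notation T := T_comonad.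

Definition chi_mor (N : gset G) :
    ghom (tw_gset (prod_gset L N)) (prod_gset L (tw_gset N)).
Proof.
refine (@GHom G (tw_gset (prod_gset L N)) (prod_gset L (tw_gset N))
  (fun p => (act p.1 p.2.1, (p.1, p.2.2))) _).
by move=> g [a [l n]] /=; rewrite actM.
Defined.

Definition chi_nt : nat_trans (T \of S) (S \of T).
Proof.
refine (@NatTrans _ _ (T \of S) (S \of T) chi_mor _).
by move=> N N' f; apply: ghom_ext.
Defined.

Definition chi : distr_law T S.
Proof.
refine (@DistrLaw gset_cat T S chi_nt _ _ _ _).
- by move=> N; apply: ghom_ext => -[a [l n]] /=.
- by move=> N; apply: ghom_ext.
- by move=> N; apply: ghom_ext => -[a [l n]] /=; rewrite act1.
- by move=> N; apply: ghom_ext.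
Defined.

Section Lambda.
Variable h : ghom L regular.

Definition lambda_tilde_mor (N : gset G) : ghom (prod_gset L N) (tw_gset N).
Proof.
refine (@GHom G (prod_gset L N) (tw_gset N)
  (fun p => (h p.1, act (h p.1)^-1 p.2)) _).
by move=> g [b n] /=; rewrite ghomP /= -actM invgM -mulgA mulVg mulg1.
Defined.

Definition lambda_tilde : nat_trans S T.
Proof.
refine (@NatTrans _ _ S T lambda_tilde_mor _).
by move=> N N' f; apply: ghom_ext => -[b n] /=; rewrite ghomP.
Defined.

Definition lambda : nat_trans (orbits_functor \of S) (orbits_functor \of T) :=
  whiskerl orbits_functor lambda_tilde.

Lemma lambdaE (N : gset G) (b : L) (n : N) :
  lambda N (orbit_class ((b, n) : prod_gset L N))
  = orbit_class ((h b, act (h b)^-1 n) : tw_gset N).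
Proof. exact: orbits_map_class. Qed.

End Lambda.

Definition Q_comonad : comonad (coalg_cat S) := lift_comonad chi.

Lemma Q_coactE (X : coalgebra S) (g : G) (x : coalg_ob X) :
  coact (Q_comonad X) (g, x) = (act g (coact X x).1, (g, x)).
Proof.
have := congr1 (fun f : ghom _ _ => f x) (coact_counit X).
by rewrite /=; case: (coact X x) => l y /= ->.
Qed.

Lemma toopE (lam : nat_trans (orbits_functor \of S) (orbits_functor \of T))
    (X : coalgebra S) (x : coalg_ob X) :
  toop chi lam X (orbit_class x)
  = lam (coalg_ob X) (orbit_class (((coact X x).1, x) : prod_gset L (coalg_ob X))).
Proof.
rewrite /= /toop_comp /= orbits_map_class; congr (lam _ (orbit_class _)).
have := congr1 (fun f : ghom _ _ => f x) (coact_counit X).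
by rewrite /=; case: (coact X x) => l y /= ->.
Qed.

End Chi.

End GSets.

(* Main.v *)
(* The orbit set (G ~x N)/G is N itself, so an opcoalgebra structure is a family
   of maps X/G -> X, natural in X over L. For b in L, the equivariant map
   G -> L, g |-> g b, makes G a coalgebra, and nabla sends its only orbit to some
   [1, k(b)]; put h(b) = k(b)^-1. A point x of X over b is a coalgebra map from
   this G to X, so naturality gives nabla[x] = [1, k(b) x] = [h(b), h(b)^-1 x];
   comparing x = 1 with x = g in G shows that h is equivariant. Thus every natural
   transformation MV => MVQ comes from some h, and the opcoalgebra axioms hold
   automatically. In the other direction, lambda_N is recovered from its value on
   the cofree coalgebra L x N. *)
Require Import Defs.
From mathcomp Require Import all_boot.
From mathcomp Require Import boolp classical_sets.
Set Implicit Arguments.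
Unset Strict Implicit.
Unset Printing Implicit Defensive.

Local Open Scope cat_scope.

Section ChiCoalgebras.
Variables (C Z : category) (S T : comonad C) (chi : distr_law T S).
Variable M : functor C Z.

(** Each axiom of [lam] is precomposed with [fmap M (coact X)]. Coassociativity of the coaction
    trades [comul S] for [fmap S (coact X)], and naturality of [lam] carries this across to form
    [lift_coact X]. *)
Lemma toop_opcoalgebra (lam : nat_trans (M \of S) (M \of T)) :
  is_chi_coalgebra chi lam -> is_opcoalgebra (toop chi lam).
Proof.
case=> lam_counit lam_comul; split=> X; rewrite /= /toop_comp.
  by rewrite compmA lam_counit /= -(fmapM M) coact_counit fmap1.
have coassoc : fmap M (comul S (coalg_ob X)) \oc fmap M (coact X)
    = fmap M (fmap S (coact X)) \oc fmap M (coact X).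
  by rewrite -!(fmapM M) coact_coassoc.
rewrite compmA lam_comul -(compmA _ _ (fmap M (coact X))) coassoc.
rewrite /lift_coact fmapM !compmA; congr (_ \oc _).
rewrite -!compmA; congr (_ \oc (_ \oc _)).
exact: esym (nt_nat lam (coact X)).
Qed.

Definition cofree (N : C) : coalg_cat S :=
  @Coalgebra C S (S N) (comul S N) (comonad_counitl S N) (comonad_coassoc S N).

(** Naturality of [lam] along [counit S N] brings the counit next to the coaction [comul S N], where
    the two cancel. *)
Lemma cofree_toop (lam : nat_trans (M \of S) (M \of T)) (N : C) :
  fmap M (fmap T (counit S N)) \oc toop chi lam (cofree N) = lam N.
Proof.
rewrite /= /toop_comp /= compmA.
have /= -> := nt_nat lam (counit S N).
by rewrite -compmA -(fmapM M) comonad_counitr fmap1 compm1.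
Qed.

Lemma toop_inj : injective (@toop C S T chi Z M).
Proof.
move=> lam lam' eq_toop; apply: nat_trans_ext => N.
by rewrite -(cofree_toop lam) eq_toop cofree_toop.
Qed.

End ChiCoalgebras.

Section Orbits.
Local Open Scope group_scope.
Variables (G : groupType) (L : gset G).

Lemma orbit_class_act (X : gset G) (g : G) (x : X) :
  orbit_class (act g x) = orbit_class x.
Proof.
apply: orbits_ext; apply/seteqP; split=> _ [k _ <-] /=.
  by exists (k * g) => //; rewrite actM.
by exists (k * g^-1) => //; rewrite -actM -mulgA mulVg mulg1.
Qed.

Lemma orbit_class_surj (X : gset G) (A : orbits X) :
  exists x, A = orbit_class x.
Proof. by case: A => A [x Ax]; exists x; apply: orbits_ext. Qed.

Lemma orbit_class_eq (X : gset G) (x y : X) :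
  orbit_class x = orbit_class y -> exists g, x = act g y.
Proof.
move=> /(congr1 sval) /= xy.
have : gorbit x x by exists 1 => //; rewrite act1.
by rewrite xy => -[g _ <-]; exists g.
Qed.

Lemma tw_orbit_class (N : gset G) (a : G) (n : N) :
  orbit_class ((a, n) : tw_gset N) = orbit_class ((1, n) : tw_gset N).
Proof. by rewrite -[RHS](orbit_class_act a) /= mulg1. Qed.

(** The twisted action moves only the first coordinate, so the second is an orbit invariant. *)
Lemma tw_orbit_class_inj (N : gset G) (a a' : G) (n n' : N) :
  orbit_class ((a, n) : tw_gset N) = orbit_class ((a', n') : tw_gset N) ->
  n = n'.
Proof. by case/orbit_class_eq=> g [_ ->]. Qed.

(** Both axioms already hold for [lambda_tilde h], before passing to orbits. *)
Lemma lambda_chi_coalgebra (h : ghom L (regular G)) :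
  is_chi_coalgebra (chi L) (lambda h).
Proof.
split=> N; rewrite /lambda /= -!orbits_mapM; congr orbits_map.
  by apply: ghom_ext => -[b n] /=; rewrite -actM mulgV act1.
apply: ghom_ext => -[b n] /=.
(* [chi] turns [h(b)^-1 b] back into [b], so the outer [lambda] again uses [h(b)] and yields
   [h(b)^-1 h(b) = 1]. *)
by rewrite -actM !mulgV act1 mulVg.
Qed.

Local Notation CS := (coalg_cat (S_comonad L)).

Lemma coactE (X : CS) (x : coalg_ob X) : coact X x = ((coact X x).1, x).
Proof.
have := congr1 (fun f : ghom _ _ => f x) (coact_counit X).
by rewrite /=; case: (coact X x) => l y /= ->.
Qed.

Section OverL.
Variables (X : gset G) (p : ghom X L).

Lemma over_coactP g x :
  ((p (act g x), act g x) : prod_gset L X) = act g ((p x, x) : prod_gset L X).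
Proof. by rewrite ghomP. Qed.

Definition over_coact : @hom (gset_cat G) X (S_comonad L X) :=
  @GHom G X (prod_gset L X) (fun x => (p x, x)) over_coactP.

Lemma over_counit : counit (S_comonad L) X \oc over_coact = idm (X : gset_cat G).
Proof. exact: ghom_ext. Qed.

Lemma over_coassoc :
  comul (S_comonad L) X \oc over_coact
  = fmap (S_comonad L) over_coact \oc over_coact.
Proof. exact: ghom_ext. Qed.

Definition over : CS := Coalgebra over_counit over_coassoc.

End OverL.

Lemma translateP (X : gset G) (x : X) (g : G) (k : regular G) :
  act (act g k : G) x = act g (act (k : G) x).
Proof. exact: actM. Qed.

Definition translate (X : gset G) (x : X) : ghom (regular G) X :=
  @GHom G (regular G) X (fun k => act (k : G) x) (translateP x).

Definition regular_over (b : L) : CS := over (translate b).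

Lemma point_morP (X : CS) (x : coalg_ob X) :
  fmap (S_comonad L) (translate x) \oc coact (regular_over (coact X x).1)
  = coact X \oc translate x.
Proof.
apply: ghom_ext => g /=; rewrite ghomP.
by rewrite [in RHS]coactE.
Qed.

Definition point (X : CS) (x : coalg_ob X) : hom (regular_over (coact X x).1) X :=
  @CoalgHom _ _ (regular_over (coact X x).1) X _ (point_morP x).

Section FromOp.
Variable nabla : nat_trans (orbits_functor G \of forget (S_comonad L))
  ((orbits_functor G \of forget (S_comonad L)) \of Q_comonad L).

Lemma nabla_regularP (b : L) : exists k : G,
  nabla (regular_over b) (orbit_class (1 : regular G))
  = orbit_class ((1, k) : tw_gset (regular G)).
Proof.
have [[a k] ->] :=
  orbit_class_surj (nabla (regular_over b) (orbit_class (1 : regular G))).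
by exists k; apply: tw_orbit_class.
Qed.

(** The chosen element is unique, by [tw_orbit_class_inj]. *)
Definition base_point (b : L) : G := projT1 (cid (nabla_regularP b)).

Lemma nablaE (X : CS) (x : coalg_ob X) :
  nabla X (orbit_class x)
  = orbit_class ((1, act (base_point (coact X x).1) x) : tw_gset (coalg_ob X)).
Proof.
have /(congr1 (fun f => f (orbit_class (1 : regular G)))) :=
  nt_nat nabla (point x).
rewrite /= orbits_map_class /= act1 => <-.
rewrite /base_point; case: cid => k /= ->.
by rewrite orbits_map_class.
Qed.

Lemma base_point_act (g : G) (b : L) : base_point (act g b) * g = base_point b.
Proof.
have := nablaE (X := regular_over b) (g : regular G).
have -> : orbit_class (g : regular G) = orbit_class (1 : regular G).
  by rewrite -[RHS](orbit_class_act g) /= mulg1.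
(* In [regular_over b] the point [g] lies over [act g b] and [1] over [b]; their common orbit thus
   has two computed images. *)
rewrite nablaE /= act1 => /tw_orbit_class_inj <-.
by rewrite /= mulg1.
Qed.

(** Inversion turns the right multiplication in [base_point_act] into the left action of
    [regular G]. *)
Lemma from_opP (g : G) (b : L) :
  (base_point (act g b))^-1 = act g ((base_point b)^-1 : regular G).
Proof. by rewrite -(base_point_act g b) /= invgM mulgA mulgV mul1g. Qed.

Definition from_op : ghom L (regular G) :=
  @GHom G L (regular G) (fun b => (base_point b)^-1) from_opP.

Lemma toop_from_op : toop (chi L) (lambda from_op) = nabla.
Proof.
apply: nat_trans_ext => X; apply: funext => A.
have [x ->] := orbit_class_surj A.
(* Normalising the first coordinate to [1] leaves the second, where the two inverses cancel. *)
by rewrite toopE lambdaE nablaE tw_orbit_class /= invgK.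
Qed.

End FromOp.

End Orbits.

Theorem theorem1p5 (G : groupType) (L : gset G) :
  (forall h : ghom L (regular G), is_chi_coalgebra (chi L) (lambda h)) /\
  bij_between
    (fun lam : nat_trans (orbits_functor G \of S_comonad L)
                         (orbits_functor G \of T_comonad G) =>
       exists h : ghom L (regular G), lam = lambda h)
    (fun nabla : nat_trans (orbits_functor G \of forget (S_comonad L))
                           ((orbits_functor G \of forget (S_comonad L))
                              \of Q_comonad L) =>
       is_opcoalgebra nabla)
    (fun lam => toop (chi L) lam).
Proof.
split; first exact: lambda_chi_coalgebra.
split=> [_ [h ->]|lam lam' _ _|nabla _].
- exact/toop_opcoalgebra/lambda_chi_coalgebra.
- exact: toop_inj.
- by exists (lambda (from_op nabla)); [exists (from_op nabla) | apply: toop_from_op].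
Qed.
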